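(* Let $3\le\alpha<\omega$. For all odd prime powers $p$, $\mathcal{A}^*_p\not\models e_p$ and $Pse_\alpha\models e_p$.
   Context: An ordinal is the set of smaller ordinals; sequences $s\in U^\alpha$ are functions $\alpha\to U$. For a set $U$ and $X\subseteq U^\alpha$: $C_i(X)=\{s\in U^\alpha: s \text{ agrees with some } s'\in X \text{ off } i\}$, $D_{ij}=\{s\in U^\alpha: s_i=s_j\}$, and for a permutation $\tau$ of $\alpha$, $S_\tau X=\{s\in U^\alpha: s\circ\tau\in X\}$; $P_{ij}=S_{[i,j]}$, where $[i,j]$ interchanges $i,j$ and fixes all else. $Pse_\alpha$ is the class of algebras $\langle A,+,-,C_i,D_{ij},P_{ij}\rangle_{i,j<\alpha}$ where, for some set $U$, $A$ is a set of subsets of $U^\alpha$ containing the $D_{ij}$ and closed under union $+$, complement $-$ with respect to $U^\alpha$, and all $C_i,P_{ij}$. $P(\alpha)$ is the set of permutations of $\alpha$. Construction of $\mathcal{A}_p^*$ ($p\ge3$ an odd prime power). $U=U_0\cup U_1\cup\dots\cup U_{\alpha-2}$ is a disjoint union with $|U_0|=p^2$, $|U_k|=p-1$ for $1\le k\le\alpha-2$. $U_0$ is the point set of the affine plane $AG(2,p)$ over the field $GF(p)$ with $p$ elements; $\Lambda_0,\dots,\Lambda_p$ are the $p+1$ parallel classes of its lines, and $R_i=\{(u,v)\in U_0\times U_0: u\neq v,\ u,v\text{ lie on a common line of }\Lambda_i\}$ for $i<p+1$. $T=U_1\times\dots\times U_{\alpha-2}$. $Q_0,\dots,Q_{p-2}$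 is a partition of the $\alpha$-place relation $R_0\times T$ into $p-1$ mutually disjoint relations such that for all $k<p-1$: $C_i(Q_k)=C_i(R_0\times T)$ for all $i<\alpha$, and $P_{01}(Q_k)=Q_{p-2-k}$. $A$ is the smallest set of subsets of $U^\alpha$ containing all $Q_k$ ($k<p-1$), all $R_i\times T$ ($1\le i<p+1$) and all $D_{ij}$, and closed under $+,-,C_i,P_{ij}$ ($i,j<\alpha$). For $\tau\in P(\alpha)$ let $\tau^+=\tau$ if $\tau(0)<\tau(1)$ and $\tau^+=\tau\circ[0,1]$ otherwise. The sets $S_\tau Q_k$ are atoms of the finite Boolean algebra $A$. The operation $P^*_{01}:A\to A$ is the additive function with $P^*_{01}(S_{\tau^+}Q_k)=S_{([0,1]\circ\tau^+)^+}Q_k$ for $\tau\in P(\alpha)$, $k<p-1$, and $P^*_{01}(a)=P_{01}(a)$ for the other atoms $a$ (this is well defined). $\mathcal{A}^*_p=\langle A,+,-,C_i,D_{ij},P^*_{01}\rangle_{i,j<\alpha}$. The equation $e_p$. In the language $+,-,c_i,d_{ij},p_{01}$ write $x\cdot y=-(-x+-y)$, $x-y=x\cdot(-y)$, $x\oplus y=(x\cdot-y)+(-x\cdot y)$, $0,1$ for the Boolean constants, $x\le y$ for $x+y=y$, $s^i_jx=c_i(d_{ij}\cdot x)$ for $i\ne j$, ${}_2s(0,1)x=s^2_0s^0_1s^1_2x$, and $x;y=c_2(s^1_2x\cdot s^0_2y)$. $E_p$ is the following finite set of equations in the variables $x_0,\dots,x_p,y_0,\dots,y_{p-2}$. For $i,j<p+1$,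 $i\neq j$: $\sum\{x_m:m<p+1\}=c_1x_0\cdot c_0x_0-d_{01}$; $x_i\cdot x_j=0$; $x_i=c_2\cdots c_{\alpha-1}x_i$ and $x_i={}_2s(0,1)x_i$; $x_i;x_i\le x_i+d_{01}$; $c_1x_i=c_1x_0$; $c_0c_1x_i=1$; $x_i;x_j=\sum\{x_k:k<p+1,\ k\neq i,j\}$. For $i,j<p-1$, $i\ne j$: $c_1\cdots c_{\alpha-1}y_0=c_1x_0$; $y_i\le x_0$; $y_i\cdot y_j=0$; $c_0y_i=c_0y_0$; $c_1y_i=c_1y_0$; $p_{01}y_0=y_0$. Finally, $e_p$ is the equation $\prod\{-c_0c_1\cdots c_{\alpha-1}(\tau\oplus\sigma): (\tau=\sigma)\in E_p\}=0$, where $\prod$ is the finite Boolean product $\cdot$. In $\mathcal{A}_p^*$ the symbols $c_i,d_{ij},p_{01}$ denote $C_i,D_{ij},P^*_{01}$; in members of $Pse_\alpha$ they denote $C_i,D_{ij},P_{01}$. *)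

(* Defs.v *)
From mathcomp Require Import all_boot all_algebra all_fingroup.
From mathcomp Require Import boolp classical_sets functions.

Set Implicit Arguments.
Unset Strict Implicit.
Unset Printing Implicit Defensive.

Local Open Scope classical_set_scope.

Section SetOperations.
Context {alpha : nat} {U : Type}.
Implicit Types (X : set ('I_alpha -> U)) (i j : 'I_alpha).

Definition Cset i X : set ('I_alpha -> U) :=
  [set s | exists2 s', X s' & forall j, j <> i -> s j = s' j].

Definition Dset i j : set ('I_alpha -> U) := [set s | s i = s j].

Definition Sset (tau : {perm 'I_alpha}) X : set ('I_alpha -> U) :=
  [set s : 'I_alpha -> U | X (fun i => s (tau i))].

Definition Pset i j X : set ('I_alpha -> U) := Sset (tperm i j) X.

Record Pse_closed (A : set (set ('I_alpha -> U))) : Prop := PseClosed {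
  Pse_closedD : forall i j, A (Dset i j);
  Pse_closedU : forall X Y, A X -> A Y -> A (X `|` Y);
  Pse_closedN : forall X, A X -> A (~` X);
  Pse_closedC : forall i X, A X -> A (Cset i X);
  Pse_closedP : forall i j X, A X -> A (Pset i j X)
}.

Lemma smallest_Pse_closed (G : set (set ('I_alpha -> U))) :
  Pse_closed (smallest Pse_closed G).
Proof.
split.
- by move=> i j M [[HD _ _ _ _] _]; exact: HD.
- by move=> X Y AX AY M [cM GM]; apply: (Pse_closedU cM); [apply: AX|apply: AY].
- by move=> X AX M [cM GM]; apply: (Pse_closedN cM); apply: AX.
- by move=> i X AX M [cM GM]; apply: (Pse_closedC cM); apply: AX.
- by move=> i j X AX M [cM GM]; apply: (Pse_closedP cM); apply: AX.
Qed.

End SetOperations.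

Record algebra (alpha : nat) := Algebra {
  carrier :> Type;
  opAdd : carrier -> carrier -> carrier;
  opNeg : carrier -> carrier;
  opCyl : 'I_alpha -> carrier -> carrier;
  opDiag : 'I_alpha -> 'I_alpha -> carrier;
  opP01 : carrier -> carrier
}.

(* The algebra of sets with universe A in which p_01 is interpreted by f. *)
Definition set_algebra (alpha : nat) (U : Type) (A : set (set ('I_alpha -> U)))
    (cA : Pse_closed A) (f : A -> A) : algebra alpha :=
  @Algebra alpha A
    (fun X Y => SigSub (mem_set (Pse_closedU cA (set_valP X) (set_valP Y))))
    (fun X => SigSub (mem_set (Pse_closedN cA (set_valP X))))
    (fun i X => SigSub (mem_set (Pse_closedC cA i (set_valP X))))
    (fun i j => SigSub (mem_set (Pse_closedD cA i j)))
    f.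

Definition ord_0 (alpha : nat) (ha : 3 <= alpha) : 'I_alpha :=
  Ordinal (leq_trans (isT : 0 < 3) ha).
Definition ord_1 (alpha : nat) (ha : 3 <= alpha) : 'I_alpha :=
  Ordinal (leq_trans (isT : 1 < 3) ha).
Definition ord_2 (alpha : nat) (ha : 3 <= alpha) : 'I_alpha :=
  Ordinal (leq_trans (isT : 2 < 3) ha).

Record Pse (alpha : nat) := MkPse {
  Pse_base : Type;
  Pse_sets : set (set ('I_alpha -> Pse_base));
  Pse_ok : Pse_closed Pse_sets
}.

(* The reduct of a member of Pse_alpha: of the P_ij only P_01 is kept. *)
Definition Pse_algebra (alpha : nat) (ha : 3 <= alpha) (B : Pse alpha) :
    algebra alpha :=
  set_algebra (Pse_ok B)
    (fun X => SigSub (mem_set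
       (Pse_closedP (Pse_ok B) (ord_0 ha) (ord_1 ha) (set_valP X)))).

Inductive variable := VarX of nat | VarY of nat.

Inductive term (alpha : nat) :=
  | Var of variable
  | Add of term alpha & term alpha
  | Neg of term alpha
  | Cyl of 'I_alpha & term alpha
  | Diag of 'I_alpha & 'I_alpha
  | P01 of term alpha.

Arguments Var {alpha} _.

Definition equation (alpha : nat) : Type := (term alpha * term alpha)%type.

Fixpoint eval (alpha : nat) (B : algebra alpha) (v : variable -> B)
    (t : term alpha) : B :=
  match t with
  | Var z => v z
  | Add t1 t2 => opAdd (eval v t1) (eval v t2)
  | Neg t1 => opNeg (eval v t1)
  | Cyl i t1 => opCyl i (eval v t1)
  | Diag i j => opDiag B i j
  | P01 t1 => opP01 (eval v t1)
  end.

Definition models (alpha : nat) (B : algebra alpha) (e : equation alpha) : Prop :=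
  forall v : variable -> B, eval v e.1 = eval v e.2.

Section DerivedTerms.
Context {alpha : nat}.
Implicit Types (x y : term alpha) (i j : 'I_alpha).

Definition tX (i : nat) : term alpha := Var (VarX i).
Definition tY (k : nat) : term alpha := Var (VarY k).

(* The signature has no Boolean constants: 1 is x_0 + -x_0. *)
Definition tOne : term alpha := Add (tX 0) (Neg (tX 0)).
Definition tZero : term alpha := Neg tOne.
Definition tMul x y : term alpha := Neg (Add (Neg x) (Neg y)).
Definition tSub x y : term alpha := tMul x (Neg y).
Definition tXor x y : term alpha := Add (tMul x (Neg y)) (tMul (Neg x) y).
Definition eqLe x y : equation alpha := (Add x y, y).
Definition tSum (ts : seq (term alpha)) : term alpha := foldr (@Add alpha) tZero ts.
Definition tProd (ts : seq (term alpha)) : term alpha := foldr tMul tOne ts.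

(* s^i_j x *)
Definition tSubst i j x : term alpha := Cyl i (tMul (Diag i j) x).

(* c_m c_(m+1) ... c_(alpha-1) x *)
Definition tCyls (m : nat) x : term alpha :=
  foldr (@Cyl alpha) x [seq i : 'I_alpha <- enum 'I_alpha | m <= i].

End DerivedTerms.

Section Equation.
Context {alpha : nat} (ha : 3 <= alpha) (p : nat).
Let o0 := ord_0 ha.
Let o1 := ord_1 ha.
Let o2 := ord_2 ha.

(* _2s(0,1)x = s^2_0 s^0_1 s^1_2 x *)
Definition t2s01 (x : term alpha) : term alpha :=
  tSubst o2 o0 (tSubst o0 o1 (tSubst o1 o2 x)).

Definition tComp (x y : term alpha) : term alpha :=
  Cyl o2 (tMul (tSubst o1 o2 x) (tSubst o0 o2 y)).

Definition eqsX (i j : nat) : seq (equation alpha) :=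
  [:: (tSum [seq tX m | m <- iota 0 p.+1],
       tSub (tMul (Cyl o1 (tX 0)) (Cyl o0 (tX 0))) (Diag o0 o1));
      (tMul (tX i) (tX j), tZero);
      (tX i, tCyls 2 (tX i));
      (tX i, t2s01 (tX i));
      eqLe (tComp (tX i) (tX i)) (Add (tX i) (Diag o0 o1));
      (Cyl o1 (tX i), Cyl o1 (tX 0));
      (Cyl o0 (Cyl o1 (tX i)), tOne);
      (tComp (tX i) (tX j),
       tSum [seq tX k | k <- iota 0 p.+1 & (k != i) && (k != j)])].

Definition eqsY (i j : nat) : seq (equation alpha) :=
  [:: (tCyls 1 (tY 0), Cyl o1 (tX 0));
      eqLe (tY i) (tX 0);
      (tMul (tY i) (tY j), tZero);
      (Cyl o0 (tY i), Cyl o0 (tY 0));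
      (Cyl o1 (tY i), Cyl o1 (tY 0));
      (P01 (tY 0), tY 0)].

Definition E_p : seq (equation alpha) :=
  flatten [seq eqsX i j | i <- iota 0 p.+1, j <- [seq j <- iota 0 p.+1 | j != i]] ++
  flatten [seq eqsY i j | i <- iota 0 p.-1, j <- [seq j <- iota 0 p.-1 | j != i]].

Definition e_p : equation alpha :=
  (tProd [seq Neg (tCyls 0 (tXor e.1 e.2)) | e <- E_p], tZero).

End Equation.

Section AffinePlane.
Context (F : finFieldType).

Definition plane : Type := 'rV[F]_2.

Definition line (a d : plane) : set plane :=
  [set (a + c *: d)%R | c in [set: F]].

Definition parallel_class (d : plane) : set (set plane) :=
  [set line a d | a in [set: plane]].

Definition parallel_classes : set (set (set plane)) :=
  [set parallel_class d | d in [set d : plane | d <> 0%R]].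

End AffinePlane.

Arguments parallel_classes F : clear implicits.

Definition odd_prime_power (p : nat) : Prop :=
  odd p /\ exists q k : nat, [/\ prime q, 0 < k & p = q ^ k].

Section Blocks.
Context {alpha : nat} (ha : 3 <= alpha) {F : finFieldType}.
Context {V : 'I_alpha.-2 -> finType}.

(* The disjoint union of U_0 = AG(2,p) and U_1, ..., U_(alpha-2), where
   U_(k+1) is V k. *)
Definition Uset : Type := (plane F + {k : 'I_alpha.-2 & V k})%type.

Definition block (u : Uset) : nat :=
  match u with inl _ => 0 | inr w => (tag w).+1 end.

(* R x T: the coordinate j >= 2 of a sequence lies in U_(j-1). *)
Definition timesT (R : set (plane F * plane F)) : set ('I_alpha -> Uset) :=
  [set s | (exists u v : plane F,
              [/\ R (u, v), s (ord_0 ha) = inl u & s (ord_1 ha) = inl v]) /\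
           (forall j : 'I_alpha, 2 <= j -> block (s j) = j.-1)].

End Blocks.

(* R_i is Rrel (Lambda_i). *)
Definition Rrel (F : finFieldType) (L : set (set (plane F))) :
    set (plane F * plane F) :=
  [set uv | uv.1 <> uv.2 /\ exists2 l, L l & l uv.1 /\ l uv.2].

(* All the choices made in the construction: the field GF(p), the numbering
   Lambda_0, ..., Lambda_p of the parallel classes, the sets U_1, ..., U_(alpha-2)
   and the partition Q_0, ..., Q_(p-2). *)
Record Astar_data (alpha : nat) (ha : 3 <= alpha) (p : nat) := AstarData {
  GFp : finFieldType;
  GFp_card : #|GFp| = p;
  Lambda : 'I_p.+1 -> set (set (plane GFp));
  Lam_bij : set_bij [set: 'I_p.+1] (parallel_classes GFp) Lambda;
  Ublk : 'I_alpha.-2 -> finType;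
  V_card : forall k, #|Ublk k| = p.-1;
  Qrel : 'I_p.-1 -> set ('I_alpha -> Uset (F := GFp) (V := Ublk));
  Q_cover : \bigcup_k Qrel k = timesT ha (Rrel (Lambda ord0));
  Q_disjoint : forall k l, k <> l -> Qrel k `&` Qrel l = set0;
  Q_cyl : forall k i, Cset i (Qrel k) = Cset i (timesT ha (Rrel (Lambda ord0)));
  (* rev_ord k has value p - 2 - k *)
  Q_swap : forall k, Pset (ord_0 ha) (ord_1 ha) (Qrel k) = Qrel (rev_ord k)
}.

(* In perm.v, (s * t) x = t (s x), so that sigma o tau is (tau * sigma)%g. *)
Definition perm_comp (alpha : nat) (sigma tau : {perm 'I_alpha}) : {perm 'I_alpha} :=
  (tau * sigma)%g.

Definition pplus (alpha : nat) (ha : 3 <= alpha) (tau : {perm 'I_alpha}) :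
    {perm 'I_alpha} :=
  if tau (ord_0 ha) < tau (ord_1 ha) then tau
  else perm_comp tau (tperm (ord_0 ha) (ord_1 ha)).

Section Astar.
Context {alpha : nat} {ha : 3 <= alpha} {p : nat} (K : Astar_data ha p).
Let o0 := ord_0 ha.
Let o1 := ord_1 ha.

Definition Astar_U : Type := Uset (F := GFp K) (V := @Ublk _ _ _ K).

Definition Astar_gens : set (set ('I_alpha -> Astar_U)) :=
  [set X | (exists k, X = Qrel k) \/
           (exists2 i : 'I_p.+1, 1 <= i & X = timesT ha (Rrel (Lambda i)))].

Definition Astar_sets : set (set ('I_alpha -> Astar_U)) :=
  smallest Pse_closed Astar_gens.

Definition Astar_closed : Pse_closed Astar_sets :=
  smallest_Pse_closed Astar_gens.

Definition Astar_atom (X : set ('I_alpha -> Astar_U)) : Prop :=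
  [/\ Astar_sets X, X <> set0 &
      forall Y, Astar_sets Y -> Y `<=` X -> Y = set0 \/ Y = X].

(* Pstar_additive determines f from its values on the atoms; f set0 = set0
   follows, the sets Sset (pplus ha tau) (Qrel k) being pairwise disjoint. *)
Record is_Pstar (f : Astar_sets -> Astar_sets) : Prop := IsPstar {
  Pstar_additive : forall X Y Z : Astar_sets,
    val Z = val X `|` val Y -> val (f Z) = val (f X) `|` val (f Y);
  Pstar_Q : forall (tau : {perm 'I_alpha}) (k : 'I_p.-1) (X : Astar_sets),
    val X = Sset (pplus ha tau) (Qrel k) ->
    val (f X) = Sset (pplus ha (perm_comp (tperm o0 o1) (pplus ha tau))) (Qrel k);
  Pstar_other : forall X : Astar_sets, Astar_atom (val X) ->
    (forall (tau : {perm 'I_alpha}) (k : 'I_p.-1),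
        val X <> Sset (pplus ha tau) (Qrel k)) ->
    val (f X) = Pset o0 o1 (val X)
}.

Definition Astar (f : Astar_sets -> Astar_sets) : algebra alpha :=
  set_algebra Astar_closed f.

End Astar.

Arguments Astar_gens {alpha ha p} K.
Arguments Astar_sets {alpha ha p} K.
Arguments Astar_closed {alpha ha p} K.
Arguments Astar_atom {alpha ha p} K X.

(* Main.v *)
From HB Require Import structures.
Require Import Defs.
From mathcomp Require Import all_boot all_algebra all_fingroup.
From mathcomp Require Import boolp classical_sets functions.
From mathcomp Require Import ring.

(** Evaluated in an algebra of subsets of U^alpha, the left-hand side of e_p is
    the whole unit if the valuation satisfies every equation of E_p and is empty
    otherwise ([den_test]), because a nonempty set cylindrified along all
    coordinates is the unit.  So an algebra of sets over a nonempty U refutes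
    e_p exactly when it has a valuation satisfying E_p.

    The third equation makes every x_i the set of sequences s with
    (s_0, s_1) in some binary relation R_i.  The remaining equations without y
    then say that R_0, ..., R_p are the relations of being joined by a line of
    the i-th parallel class, in an affine plane with p + 1 such classes
    ([parallelism], [sat_parallelism]).

    In the Pse algebras E_p is unsatisfiable.  A line of such a plane has p
    points: a point w off the line is joined to each of them in exactly one of
    the p other directions ([line_points]).  Freezing the coordinates from 2 on
    at the values of a sequence of y_0 turns the y_k into p - 1 disjoint binary
    relations inside R_0 with the same domain and the same range.  Each point a
    of the domain has p - 1 different successors, one for each y_k, which
    exhaust the other points of its line; hence y_0 is a function on this line.
    Since p_01 is the true transposition, p_01 y_0 = y_0 makes it a
    fixed-point-free involution of p points, and p is odd
    ([no_symmetric_part], [no_symmetric_splitting]).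

    In the modified algebra the intended interpretation satisfies E_p: x_i is
    given by the i-th parallel class of AG(2, p), which forms a parallelism
    ([plane_parallelism]), and y_k is Q_k.  The equation p_01 y_0 = y_0 holds
    because the modified operation, at the identity permutation, sends Q_0 to
    itself ([Pstar_Qrel]); all other equations are properties of the Q_k imposed
    by the construction. *)

Set Implicit Arguments.
Unset Strict Implicit.
Unset Printing Implicit Defensive.

Local Open Scope classical_set_scope.

(* Classical equality on terms gives access to the membership lemmas for the
   finite list of equations. *)
HB.instance Definition _ alpha := gen_eqMixin (term alpha).

(** * Cylindrifications *)

Section Cylindrifications.
Context {alpha : nat} {U : Type}.
Implicit Types (X : set ('I_alpha -> U)) (i j : 'I_alpha).

Definition upd (s : 'I_alpha -> U) i u : 'I_alpha -> U :=
  fun j => if j == i then u else s j.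

Lemma CsetE i X : Cset i X = [set s | exists u, X (upd s i u)].
Proof.
apply/seteqP; split=> s /=.
  case=> s' Xs' ss'; exists (s' i).
  suff -> : upd s i (s' i) = s' by [].
  by apply/funext => j; rewrite /upd; case: eqP => [->|/ss'].
case=> u Xu; exists (upd s i u) => // j /eqP ji.
by rewrite /upd (negbTE ji).
Qed.

Lemma Cset_foldrE X (l : seq 'I_alpha) :
  foldr Cset X l =
  [set s | exists2 s', X s' & forall j, j \notin l -> s j = s' j].
Proof.
elim: l => [|i l IH] /=.
  apply/seteqP; split=> s /= => [Xs|[s' Xs' ss']]; first by exists s.
  by have -> : s = s' by apply/funext => j; exact: ss'.
rewrite IH; apply/seteqP; split=> s /=.
  case=> s' [s'' Xs'' s's''] ss'; exists s'' => // j.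
  rewrite inE negb_or => /andP[/eqP ji jl].
  by rewrite ss' // s's''.
case=> s' Xs' ss'.
exists (fun j => if j \in l then s j else s' j).
  by exists s' => // j /negbTE ->.
move=> j /eqP/negbTE ji; case: ifPn => // jl.
by apply: ss'; rewrite inE ji.
Qed.

Lemma Cset_foldr_geE m X :
  foldr Cset X [seq i : 'I_alpha <- enum 'I_alpha | m <= i] =
  [set s | exists2 s', X s' & forall j : 'I_alpha, j < m -> s j = s' j].
Proof.
rewrite Cset_foldrE; apply/seteqP; split=> s /= [s' Xs' ss']; exists s' => // j.
  by move=> jm; apply: ss'; rewrite mem_filter mem_enum andbT -ltnNge.
by rewrite mem_filter mem_enum andbT -ltnNge; exact: ss'.
Qed.

End Cylindrifications.

(** * The value of a term in an algebra of sets *)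

Section Denotation.
Context {alpha : nat} {U : Type} {A : set (set ('I_alpha -> U))}.
Variables (cA : Pse_closed A) (f : A -> A) (v : variable -> A).
Implicit Types (t : term alpha) (e : equation alpha).

Definition denotation t : set ('I_alpha -> U) := val (eval (B := set_algebra cA f) v t).

Local Notation den := denotation.

Definition satisfied e : Prop := den e.1 = den e.2.

Local Notation sat := satisfied.

Lemma evalP e :
  eval (B := set_algebra cA f) v e.1 = eval (B := set_algebra cA f) v e.2 <->
  sat e.
Proof. by split=> [H|/val_inj//]; rewrite /satisfied /denotation H. Qed.

Lemma den_Add t1 t2 : den (Add t1 t2) = den t1 `|` den t2.
Proof. by []. Qed.

Lemma den_Neg t : den (Neg t) = ~` den t.
Proof. by []. Qed.

Lemma den_Cyl i t : den (Cyl i t) = Cset i (den t).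
Proof. by []. Qed.

Lemma den_Diag i j : den (Diag i j) = Dset i j.
Proof. by []. Qed.

Lemma den_Mul t1 t2 : den (tMul t1 t2) = den t1 `&` den t2.
Proof. by rewrite -[RHS]setCK setCI. Qed.

Lemma den_Xor t1 t2 :
  den (tXor t1 t2) = (den t1 `&` ~` den t2) `|` (~` den t1 `&` den t2).
Proof. by rewrite den_Add !den_Mul. Qed.

Lemma den_One : den tOne = setT.
Proof. exact: setUv. Qed.

Lemma den_Zero : den tZero = set0.
Proof. by rewrite -[RHS]setCT -den_One. Qed.

Lemma den_Sum ts : den (tSum ts) = [set s | exists2 t, t \in ts & den t s].
Proof.
elim: ts => [|t ts IH]; first by rewrite den_Zero; apply/seteqP; split=> s // [].
rewrite den_Add IH; apply/seteqP; split=> s /=.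
  case=> [ts0|[t' t'ts t's]]; first by exists t; rewrite ?mem_head.
  by exists t'; rewrite ?inE ?t'ts ?orbT.
by case=> t'; rewrite inE => /orP[/eqP->|t'ts t's]; [left|right; exists t'].
Qed.

Lemma den_Cyls m t :
  den (tCyls m t) =
  [set s | exists2 s', den t s' & forall j : 'I_alpha, j < m -> s j = s' j].
Proof.
rewrite -Cset_foldr_geE /tCyls.
by elim: [seq i <- _ | _] => //= i l <-.
Qed.

Lemma den_Subst (i j : 'I_alpha) t : i <> j ->
  den (tSubst i j t) = [set s | den t (upd s i (s j))].
Proof.
move=> /eqP ij; rewrite den_Cyl CsetE den_Mul den_Diag /Dset /upd.
have ji : (j == i) = false by rewrite eq_sym (negbTE ij).
apply/seteqP; split=> s /=; rewrite eqxx ji; first by case=> u [->].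
by move=> H; exists (s j).
Qed.

(** The left-hand side of e_p tests, at any one sequence, whether the valuation
    satisfies all of E: the cylindrified symmetric difference of the two sides of
    an equation is empty or everything. *)
Lemma den_test E s :
  den (tProd [seq Neg (tCyls 0 (tXor e.1 e.2)) | e <- E]) s <->
  {in E, forall e, sat e}.
Proof.
elim: E => [|e E IH] /=; first by rewrite den_One.
rewrite forall_cons -IH [tProd _]/= den_Mul /=; apply: and_iff_compat_r.
rewrite den_Neg den_Cyls /=.
rewrite den_Xor; split=> [H|->]; last by case=> s' [] [].
apply/seteqP; split=> s' /= es'; apply: contrapT => Nes'; apply: H.
  by exists s' => //; left.
by exists s' => //; right.
Qed.

End Denotation.

(** * The equations on the x_i *)

(** What the equations on the x_i say of the binary relations behind them.  With
    R_i read as joined by a line of the i-th class, it describes an affine plane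
    on the common domain of the R_i: two distinct points are joined in exactly
    one direction, each R_i is an equivalence once the diagonal is added, and
    lines in two different directions meet. *)
Record parallelism (U : Type) (p : nat) (R : nat -> U -> U -> Prop) : Prop :=
  Parallelism {
  par_cover : forall u v, (exists2 m, m <= p & R m u v) <->
    [/\ exists w, R 0 u w, exists w, R 0 w v & u <> v];
  par_disj : forall i j u v, i <= p -> j <= p -> j != i -> R i u v -> ~ R j u v;
  par_sym : forall i u v, i <= p -> R i u v -> R i v u;
  par_trans : forall i u v w, i <= p -> R i u v -> R i v w -> R i u w \/ u = w;
  par_dom : forall i u, i <= p -> (exists w, R i u w) <-> (exists w, R 0 u w);
  par_ex : forall i, i <= p -> exists u v, R i u v;
  par_comp : forall i j u v, i <= p -> j <= p -> j != i ->
    (exists2 w, R i u w & R j w v) <->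
    (exists2 k, k <= p & [/\ k != i, k != j & R k u v])
}.

Section Binary.
Context {alpha : nat} (ha : 3 <= alpha) {U : Type}.
Let o0 := ord_0 ha.
Let o1 := ord_1 ha.
Let o2 := ord_2 ha.
Implicit Types P Q : U -> U -> Prop.

Definition binary P : set ('I_alpha -> U) := [set s | P (s o0) (s o1)].

Lemma binary_inj P Q : binary P = binary Q <-> forall u v, P u v <-> Q u v.
Proof.
split=> [PQ u v|PQ]; last by apply/seteqP; split=> s /= /PQ.
have := congr1 (fun X => X (fun i => if i == o0 then u else v)) PQ.
by rewrite /binary /= => ->.
Qed.

Lemma Cset0_binary P : Cset o0 (binary P) = binary (fun _ v => exists u, P u v).
Proof. by rewrite CsetE. Qed.

Lemma Cset1_binary P : Cset o1 (binary P) = binary (fun u _ => exists v, P u v).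
Proof. by rewrite CsetE. Qed.

(** Cylindrifying from 2 on leaves a condition on the first two coordinates. *)
Lemma tCyls2_binary X :
  [set s | exists2 s', X s' & forall j : 'I_alpha, j < 2 -> s j = s' j] =
  binary (fun u v => exists s, [/\ X s, s o0 = u & s o1 = v]).
Proof.
apply/seteqP; split=> s /=.
  by case=> s' Xs' ss'; exists s'; rewrite !ss'.
case=> s' [Xs' s0 s1]; exists s' => // -[[|[|]]] //= hj _.
  by rewrite (_ : Ordinal hj = o0) ?s0 //; apply/val_inj.
by rewrite (_ : Ordinal hj = o1) ?s1 //; apply/val_inj.
Qed.

Context {A : set (set ('I_alpha -> U))}.
Variables (cA : Pse_closed A) (f : A -> A) (v : variable -> A).
Implicit Types (t : term alpha).
Local Notation den := (denotation cA f v).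
Local Notation sat := (satisfied cA f v).

Lemma den_2s01 t P : den t = binary P -> den (t2s01 ha t) = binary (fun u w => P w u).
Proof. by move=> tP; rewrite /t2s01 !den_Subst// tP. Qed.

Lemma den_Comp t1 t2 P1 P2 : den t1 = binary P1 -> den t2 = binary P2 ->
  den (tComp ha t1 t2) = binary (fun u w => exists2 z, P1 u z & P2 z w).
Proof.
move=> t1P t2P; rewrite den_Cyl CsetE den_Mul.
rewrite !den_Subst// t1P t2P.
by apply/seteqP; split=> s /= [w]; [case=> H1 H2|move=> H1 H2]; exists w.
Qed.

Lemma sat_E_p p : {in E_p ha p, forall e, sat e} <->
  (forall i j, i <= p -> j <= p -> j != i -> {in eqsX ha p i j, forall e, sat e}) /\
  (forall i j, i < p.-1 -> j < p.-1 -> j != i -> {in eqsY ha i j, forall e, sat e}).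
Proof.
have memE (F : nat -> nat -> seq (equation alpha)) n e :
    e \in flatten [seq F i j | i <- iota 0 n, j <- [seq j <- iota 0 n | j != i]] <->
    exists i j, [/\ i < n, j < n, j != i & e \in F i j].
  split=> [/flattenP[l /allpairsPdep[i [j []]]]|[i [j [i_n j_n ji eF]]]].
    rewrite mem_filter !mem_iota /= => i_n /andP[ji j_n ->] eF.
    by exists i, j.
  apply/flattenP; exists (F i j) => //; apply/allpairsPdep; exists i, j.
  by rewrite mem_filter !mem_iota /= ji.
split=> [H|[HX HY] e].
  by split=> i j i_p j_p ji e eF; apply: H; rewrite mem_cat; apply/orP;
    [left|right]; apply/memE; exists i, j.
by rewrite mem_cat => /orP[] /memE[i [j [i_p j_p ji]]]; [apply: HX|apply: HY].
Qed.

Section EqsX.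
Variables (p : nat) (R : nat -> U -> U -> Prop).
Hypothesis denX : forall i, i <= p -> den (tX i) = binary (R i).

Lemma den_SumX (a : pred nat) :
  den (tSum [seq tX k | k <- iota 0 p.+1 & a k]) =
  binary (fun u w => exists2 k, k <= p & a k /\ R k u w).
Proof.
rewrite den_Sum; apply/seteqP; split=> s.
  case=> _ /mapP[k + ->]; rewrite mem_filter mem_iota /= => /andP[ak k_p].
  by rewrite denX //; exists k.
case=> k k_p [ak Rk]; exists (tX k); last by rewrite denX.
by apply/mapP; exists k; rewrite // mem_filter ak mem_iota.
Qed.

(** Both sides of each equation are of the form [binary P], and such sets are
    equal exactly when the relations are equivalent. *)
Lemma sat_eqsX i j : i <= p -> j <= p ->
  {in eqsX ha p i j, forall e, sat e} <->
  (forall u w, (exists2 m, m <= p & R m u w) <->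
     [/\ exists z, R 0 u z, exists z, R 0 z w & u <> w]) /\
  (forall u w, ~ (R i u w /\ R j u w)) /\
  (forall u w, R i u w <-> R i w u) /\
  (forall u w, (exists2 z, R i u z & R i z w) -> R i u w \/ u = w) /\
  (forall u : U, (exists w, R i u w) <-> (exists w, R 0 u w)) /\
  (U -> exists u w, R i u w) /\
  (forall u w, (exists2 z, R i u z & R j z w) <->
     exists2 k, k <= p & [/\ k != i, k != j & R k u w]).
Proof.
move=> i_p j_p; rewrite /eqsX !forall_cons.
have -> : {in [::], forall e, sat e} <-> True by [].
have X0 := denX (leq0n p); have Xi := denX i_p; have Xj := denX j_p.
have C1 k : k <= p -> den (Cyl o1 (tX k)) = binary (fun u _ => exists w, R k u w).
  by move=> k_p; rewrite -Cset1_binary -denX.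
have C0 k : k <= p -> den (Cyl o0 (tX k)) = binary (fun _ w => exists u, R k u w).
  by move=> k_p; rewrite -Cset0_binary -denX.
have satE t1 t2 : sat (t1, t2) = (den t1 = den t2) by [].
have binU P Q : binary P `|` binary Q = binary (fun u w => P u w \/ Q u w) by [].
have binI P Q : binary P `&` binary Q = binary (fun u w => P u w /\ Q u w) by [].
have binD : Dset o0 o1 = binary (fun u w => u = w) by [].
have bin0 : set0 = binary (fun _ _ => False) by [].
have bin1 : setT = binary (fun _ _ => True) by [].
have binN P : ~` binary P = binary (fun u w => ~ P u w) by [].
have -> : [seq @tX alpha m | m <- iota 0 p.+1] =
    [seq tX m | m <- iota 0 p.+1 & predT m] by rewrite filter_predT.
have := den_Cyls cA f v 2 (tX i); rewrite tCyls2_binary Xi => Cyl2.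
rewrite /eqLe !satE !den_SumX den_Zero den_One Cyl2 !den_Mul !den_Add (den_2s01 Xi).
rewrite (den_Comp Xi Xi) (den_Comp Xi Xj).
rewrite den_Neg !den_Cyl X0 Xi Xj den_Diag binD.
rewrite !Cset0_binary !Cset1_binary bin0 bin1 !binN !binU !binI.
have binj P Q : (binary P = binary Q) = (forall u w, P u w <-> Q u w).
  exact/propext/binary_inj.
rewrite !Cset0_binary !binj; split.
  case=> E1 [E2 [_ [E4 [E5 [E6 [E7 [E8 _]]]]]]].
  split; [|split; [|split; [|split; [|split; [|split]]]]] => //.
  - move=> u w; split=> [[m m_p Rm]|[Ru Rw uw]].
      by have [[Ru Rw] uw] := (E1 u w).1 (ex_intro2 _ _ m m_p (conj isT Rm)).
    by have [m m_p [_ Rm]] := (E1 u w).2 (conj (conj Ru Rw) uw); exists m.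
  - by move=> u w /E2.
  - by move=> u w H; apply/E5; left.
  - by move=> u; exact: E6.
  - by move=> u; exact/(E7 u u).
  - move=> u w; rewrite E8; split=> -[k k_p].
      by case=> /andP[ki kj] Rk; exists k.
    by case=> ki kj Rk; exists k; rewrite // ki kj.
case=> E1 [E2 [E4 [E5 [E6 [E7 E8]]]]].
split; [|split; [|split; [|split; [|split; [|split; [|split; [|split]]]]]]] => //.
- move=> u w; split=> [[m m_p [_ Rm]]|[[Ru Rw] uw]].
    by have [Ru Rw uw] := (E1 u w).1 (ex_intro2 _ _ m m_p Rm).
  by have [m m_p Rm] := (E1 u w).2 (And3 Ru Rw uw); exists m.
- by move=> u w; split=> // /E2.
- move=> u w; split=> [Ruw|[s [Rs <- <-]]] //.
  by exists (fun k => if k == o0 then u else w).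
- by move=> u w; split=> [[/E5|]|]; auto.
- by move=> u _; split=> // _; exact: E7.
- move=> u w; rewrite E8; split=> -[k k_p].
    by case=> ki kj Rk; exists k; rewrite // ki kj.
  by case=> /andP[ki kj] Rk; exists k.

Qed.

End EqsX.

(** The equations come in blocks indexed by pairs i <> j.  Since p > 0 every i has
    a partner j, so properties that involve i alone are available for all i. *)
Lemma sat_parallelism p (R : nat -> U -> U -> Prop) (u0 : U) : 0 < p ->
    (forall i, i <= p -> den (tX i) = binary (R i)) ->
  (forall i j, i <= p -> j <= p -> j != i -> {in eqsX ha p i j, forall e, sat e}) <->
  parallelism p R.
Proof.
move=> p_gt0 denX; split.
  move=> H.
  have H' i j i_p j_p ji := (sat_eqsX denX i_p j_p).1 (H i j i_p j_p ji).
  have other i : i <= p -> exists2 j, j <= p & j != i.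
    by move=> i_p; exists (i == 0) => //; [case: (i == 0)|case: i i_p].
  split.
  - by have [E _] := H' 0 1 isT p_gt0 isT.
  - move=> i j u w i_p j_p ji Ri Rj.
    by have [_ [/(_ u w)E _]] := H' i j i_p j_p ji; apply: E.
  - move=> i u w i_p; have [j j_p ji] := other i i_p.
    by have [_ [_ [/(_ u w)E _]]] := H' i j i_p j_p ji; rewrite E.
  - move=> i u w z i_p Ruw Rwz; have [j j_p ji] := other i i_p.
    by have [_ [_ [_ [E _]]]] := H' i j i_p j_p ji; apply: E; exists w.
  - move=> i u i_p; have [j j_p ji] := other i i_p.
    by have [_ [_ [_ [_ [E _]]]]] := H' i j i_p j_p ji.
  - move=> i i_p; have [j j_p ji] := other i i_p.
    by have [_ [_ [_ [_ [_ [E _]]]]]] := H' i j i_p j_p ji; apply: E.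
  - move=> i j u w i_p j_p ji.
    by have [_ [_ [_ [_ [_ [_ E]]]]]] := H' i j i_p j_p ji.
move=> [E1 E2 E3 E4 E5 E6 E7] i j i_p j_p ji; apply/(sat_eqsX denX i_p j_p).
split; [|split; [|split; [|split; [|split; [|split]]]]] => //.
- by move=> u w [Ri Rj]; apply: E2 Ri Rj.
- by move=> u w; split; apply: E3.
- by move=> u w [z Ruz Rzw]; apply: E4 Ruz Rzw.
- by move=> u; exact: E5.
- by move=> _; exact: E6.
- by move=> u w; exact: E7.
Qed.
End Binary.

(** * A parity obstruction *)

Section Parity.
Variable T : finType.

(** Without a fixed point, the elements that an involution moves up and those
    that it moves down are exchanged by it and exhaust T. *)
Lemma odd_involution_fixpoint (g : T -> T) :
  involutive g -> odd #|T| -> exists x, g x = x.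
Proof.
move=> gK; apply: contraPP => /forallNP gN.
rewrite -cardsT; have -> : [set: T]%SET = ([set x | enum_rank x < enum_rank (g x)] :|:
    [set x | enum_rank (g x) < enum_rank x])%SET.
  apply/setP => x; rewrite !inE; case: ltngtP => // /val_inj/enum_rank_inj gx.
  by case: (gN x).
rewrite cardsU (_ : _ :&: _ = finset.set0)%SET; last first.
  by apply/setP => x; rewrite !inE; case: ltngtP.
have -> : [set x | enum_rank (g x) < enum_rank x]%SET =
    (g @: [set x | enum_rank x < enum_rank (g x)])%SET.
  apply/setP => x; rewrite -[in RHS](gK x) (mem_imset _ _ (inv_inj gK)).
  by rewrite !inE gK.
by rewrite card_imset ?cards0 ?subn0 ?addnn ?odd_double //; exact: inv_inj.
Qed.

(** At a point a of the common domain, one Y_i-successor for each i makes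
    #|T| - 1 different points, hence all points other than a.  So every point is
    in the common domain, and every b <> a is related to a by exactly one Y_i.
    In particular Y_0 is the graph of an involution without fixed point. *)
Lemma no_symmetric_part (Y : nat -> T -> T -> Prop) : odd #|T| -> 1 < #|T| ->
    (forall i a b, i < #|T|.-1 -> Y i a b -> a <> b) ->
    (forall i j a b, i < #|T|.-1 -> j < #|T|.-1 -> Y i a b -> Y j a b -> i = j) ->
    (forall i a, i < #|T|.-1 -> (exists b, Y i a b) <-> exists b, Y 0 a b) ->
    (forall i b, i < #|T|.-1 -> (exists a, Y i a b) <-> exists a, Y 0 a b) ->
    (forall a b, Y 0 a b -> Y 0 b a) ->
  forall a b, ~ Y 0 a b.
Proof.
move=> oddT T_gt1 Yirr Ydisj Ydom Yran Ysym a0 b0 Y0ab.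
have n_gt0 : 0 < #|T|.-1 by case: #|T| T_gt1 => [|[]].
have row a : (exists b, Y 0 a b) ->
    exists2 h : 'I_#|T|.-1 -> T, forall i : 'I_#|T|.-1, Y i a (h i) &
      forall b, b <> a -> exists i, h i = b.
  move=> Ya.
  have /choice[h Yh] (i : 'I_#|T|.-1) : exists c, Y i a c by apply/Ydom.
  have h_inj : injective h.
    move=> i j hij; apply/val_inj/(Ydisj _ _ _ _ (ltn_ord i) (ltn_ord j) (Yh i)).
    by rewrite hij.
  exists h => // b ba.
  have : (h @: [set: 'I_#|T|.-1] == [set~ a])%SET.
    rewrite eqEcard cardsC1 card_imset // cardsT card_ord leqnn andbT.
    apply/fintype.subsetP => c /imsetP[i _ ->]; rewrite !inE; apply/eqP => hia.
    by apply: Yirr (ltn_ord i) (Yh i) (esym hia).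
  move=> /eqP/setP/(_ b); rewrite !inE (introF eqP ba) => /imsetP[i _ ->].
  by exists i.
have dom a : exists b, Y 0 a b.
  have Ya0 : exists b, Y 0 a0 b by exists b0.
  have [->//|/eqP aa0] := eqVneq a a0.
  have [h Yh /(_ _ aa0)[i hi]] := row _ Ya0.
  have [b Yba] : exists b, Y 0 b a.
    by apply/(Yran _ _ (ltn_ord i)); exists a0; rewrite -hi.
  by exists b; exact: Ysym.
have fct a b c : Y 0 a b -> Y 0 a c -> b = c.
  have [h Yh h_onto] := row _ (dom a).
  suff only d : Y 0 a d -> d = h (Ordinal n_gt0) by move=> /only-> /only->.
  move=> Yad; have [|i hi] := h_onto d; first exact/nesym/(Yirr _ _ _ n_gt0).
  rewrite -hi; congr h; apply/val_inj/(Ydisj _ _ _ _ (ltn_ord i) n_gt0 (Yh i)).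
  by rewrite hi.
have [g Yg] := choice dom.
have gK : involutive g by move=> a; apply: fct (Yg _) (Ysym _ _ (Yg a)).
have [a ga] := odd_involution_fixpoint gK oddT.
by apply: Yirr n_gt0 (Yg a) (esym ga).
Qed.
End Parity.

(** * Lines of a parallelism *)

Section LinePoints.
Variables (U : Type) (p : nat) (R : nat -> U -> U -> Prop).
Hypotheses (p_gt0 : 0 < p) (parR : parallelism p R).

Lemma par_irr i u v : i <= p -> R i u v -> u <> v.
Proof.
move=> i_p Ruv.
by have [_ _] := (par_cover parR u v).1 (ex_intro2 _ _ i i_p Ruv).
Qed.

(** The line through u in direction 0 has p points.  A point w joined to u in
    direction 1 lies off that line, and the line through w in a direction k > 0
    meets it in a single point; this matches its points with the directions
    1, ..., p. *)
Lemma line_points u : (exists v, R 0 u v) ->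
  exists2 pt : 'I_p -> U, injective pt &
    forall v, (v = u \/ R 0 u v) <-> exists k, v = pt k.
Proof.
move=> Ru; have [w Ruw] := (par_dom parR u p_gt0).2 Ru.
have Rwu := par_sym parR p_gt0 Ruw.
have wNl v : v = u \/ R 0 u v -> v <> w /\ ~ R 0 v w.
  have Nuw := @par_irr _ _ _ p_gt0 Ruw.
  have N0uw : ~ R 0 u w by exact: (par_disj parR p_gt0 (leq0n p) isT Ruw).
  case=> [->|Ruv] //; split=> [vw|Rvw]; first by apply: N0uw; rewrite -vw.
  by have [] := par_trans parR (leq0n p) Ruv Rvw.
have meet (k : 'I_p) : exists v, (v = u \/ R 0 u v) /\ R k.+1 w v.
  (* In direction 1 the point is u; in another one it comes from splitting
     the step from u to w. *)
  have [k0|k0] := eqVneq k.+1 1.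
    by exists u; rewrite k0; split=> //; left.
  have [z Ruz Rzw] : exists2 z, R 0 u z & R k.+1 z w.
    by apply/(par_comp parR) => //; exists 1 => //; rewrite eq_sym in k0.
  by exists z; split; [right|apply: (par_sym parR)].
have [pt ptP] := choice meet.
have l_trans v v' : (v = u \/ R 0 u v) -> (v' = u \/ R 0 u v') -> R 0 v v' \/ v = v'.
  case=> [->|Ruv] [->|Ruv']; [by right|by left|left|].
    exact: (par_sym parR).
  exact: (par_trans parR (leq0n p) (par_sym parR (leq0n p) Ruv) Ruv').
exists pt.
  move=> k l kl; have [_ Rk] := ptP k; have [_ Rl] := ptP l.
  apply/val_inj/eqP/negPn/negP => k_l; rewrite -kl in Rl.
  by apply: (par_disj parR _ _ _ Rk Rl); rewrite // eq_sym eqSS.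
move=> v; split=> [vl|[k ->]]; last by have [] := ptP k.
have [vw N0vw] := wNl v vl.
have [m m_p Rwv] : exists2 m, m <= p & R m w v.
  apply/(par_cover parR); split; last exact/nesym.
    by apply/(par_dom parR _ p_gt0); exists u.
  case: vl => [->|Ruv]; last by exists u.
  by have [z Ruz] := Ru; exists z; exact: (par_sym parR).
case: m m_p Rwv => [_ /(par_sym parR (leq0n p))//|m m_p Rwv].
exists (Ordinal m_p); have [pl Rwp] := ptP (Ordinal m_p).
have [Rvp|//] := l_trans v _ vl pl.
have [Rmvp|//] := par_trans parR m_p (par_sym parR m_p Rwv) Rwp.
by case: (@par_disj _ _ _ parR 0 m.+1 v (pt (Ordinal m_p))).
Qed.

(** The relations Y_i lie inside R_0, so they restrict to the line of one of
    their points, which has p points, an odd number. *)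
Lemma no_symmetric_splitting (Y : nat -> U -> U -> Prop) : odd p -> 1 < p ->
    (forall i u v, i < p.-1 -> Y i u v -> R 0 u v) ->
    (forall i j u v, i < p.-1 -> j < p.-1 -> j != i -> Y i u v -> ~ Y j u v) ->
    (forall i u, i < p.-1 -> (exists v, Y i u v) <-> exists v, Y 0 u v) ->
    (forall i v, i < p.-1 -> (exists u, Y i u v) <-> exists u, Y 0 u v) ->
    (forall u v, Y 0 u v -> Y 0 v u) ->
  forall u v, ~ Y 0 u v.
Proof.
move=> p_odd p_gt1 YR Ydisj Ydom Yran Ysym u v Yuv.
have n_gt0 : 0 < p.-1 by case: p p_gt1 => [|[]].
have [pt pt_inj ptP] := line_points (ex_intro _ v (YR _ _ _ n_gt0 Yuv)).
have R0_line k w : R 0 (pt k) w -> exists l, w = pt l.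
  move=> Rkw; apply/ptP.
  have [<-|Ruk] := (ptP (pt k)).2 (ex_intro _ k erefl); first by right.
  by have [|] := par_trans parR (leq0n p) Ruk Rkw; [right|left].
have [k uk] := (ptP u).1 (or_introl erefl).
have [l vl] := (ptP v).1 (or_intror (YR _ _ _ n_gt0 Yuv)).
apply: (@no_symmetric_part _ (fun i k l => Y i (pt k) (pt l)) _ _ _ _ _ _ _ k l);
  rewrite ?card_ord -?uk -?vl //.
- by move=> i a b i_n /YR-/(_ i_n)/(par_irr (leq0n p)) ab /(congr1 pt).
- move=> i j a b i_n j_n Yi Yj; apply/eqP/negPn/negP; rewrite eq_sym => ij.
  exact: (Ydisj i j) Yi Yj.
- have E i a : i < p.-1 -> (exists b, Y i (pt a) (pt b)) <-> exists b, Y i (pt a) b.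
    move=> i_n; split=> [[b Yab]|[b Yab]]; first by exists (pt b).
    by have [c bc] := R0_line _ _ (YR _ _ _ i_n Yab); exists c; rewrite -bc.
  by move=> i a i_n; rewrite !E // Ydom.
- have E i b : i < p.-1 -> (exists a, Y i (pt a) (pt b)) <-> exists a, Y i a (pt b).
    move=> i_n; split=> [[a Yab]|[a Yab]]; first by exists (pt a).
    have [c ac] := R0_line _ _ (par_sym parR (leq0n p) (YR _ _ _ i_n Yab)).
    by exists c; rewrite -ac.
  by move=> i a i_n; rewrite !E // Yran.
- by move=> a b; exact: Ysym.
Qed.

End LinePoints.

(** * The equation holds in Pse *)

Section SetAlgebras.
Context {alpha : nat} (ha : 3 <= alpha).
Let o0 := ord_0 ha.
Let o1 := ord_1 ha.

Lemma updC (U : Type) (s : 'I_alpha -> U) u w :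
  upd (upd s o0 u) o1 w = upd (upd s o1 w) o0 u.
Proof.
by apply/funext => i; rewrite /upd; case: eqP => // ->.
Qed.

Lemma Pse_models_e_p p : odd p -> 1 < p ->
  forall B : Pse alpha, models (Pse_algebra ha B) (e_p ha p).
Proof.
move=> p_odd p_gt1 [U A cA] v; apply/evalP.
set f := fun X : A => _.
rewrite /satisfied den_Zero; apply/seteqP; split=> // s /den_test/sat_E_p[HX HY].
have p_gt0 : 0 < p by exact: ltnW.
have n_gt0 : 0 < p.-1 by rewrite -subn1 subn_gt0.
have n_gt1 : 1 < p.-1 by case: (p) p_odd p_gt1 => [|[|[|]]].
pose den := denotation cA f v.
pose R i u w := exists s, [/\ den (tX i) s, s o0 = u & s o1 = w].
have denX i : i <= p -> den (tX i) = binary ha (R i).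
  move=> i_p; have [j j_p ji] : exists2 j, j <= p & j != i.
    by exists (i == 0) => //; [case: (i == 0)|case: i i_p].
  have := HX i j i_p j_p ji; rewrite /eqsX !forall_cons => -[_ [_ [E _]]].
  by rewrite [den _]E den_Cyls tCyls2_binary.
have parR : parallelism p R by apply/(sat_parallelism (s o0) p_gt0 denX).
have eqY i : i < p.-1 -> [/\ den (tY i) `<=` den (tX 0),
    Cset o0 (den (tY i)) = Cset o0 (den (tY 0)) &
    Cset o1 (den (tY i)) = Cset o1 (den (tY 0))].
  move=> i_n; have [j j_n ji] : exists2 j, j < p.-1 & j != i.
    by exists (i == 0) => //; [case: (i == 0)|case: i i_n].
  have := HY i j i_n j_n ji; rewrite /eqsY !forall_cons.
  case=> [_ [E1 [_ [E2 [E3 _]]]]]; split; [|exact: E2|exact: E3].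
  by rewrite -[X in _ `<=` X]E1; left.
have := HY 0 1 n_gt0 n_gt1 isT; rewrite /eqsY !forall_cons.
case=> [E1 [_ [_ [_ [_ [E6 _]]]]]].
have {E1}[s0 Ys0] : exists s0, den (tY 0) s0.
  have [u [w Ruw]] := par_ex parR (leq0n p).
  have : den (Cyl o1 (tX 0)) (upd s o0 u).
    rewrite /den den_Cyl -/den denX // Cset1_binary.
    by exists w.
  by rewrite /den -[X in X _]E1 den_Cyls => -[s' Ys' _]; exists s'.
(* The coordinates from 2 on are frozen at those of a sequence of y_0. *)
pose Y i u w := den (tY i) (upd (upd s0 o0 u) o1 w).
have YR i u w : i < p.-1 -> Y i u w -> R 0 u w.
  by move=> i_n Yi; have [/(_ _ Yi)] := eqY i i_n; rewrite denX.
apply: (@no_symmetric_splitting U p R p_gt0 parR Y _ _ YR _ _ _ _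
  (s0 o0) (s0 o1)) => //.
- move=> i j u w i_n j_n ji Yi Yj.
  have := HY i j i_n j_n ji; rewrite /eqsY !forall_cons => -[_ [_ [E _]]].
  have : den (tMul (tY i) (tY j)) (upd (upd s0 o0 u) o1 w) by rewrite /den den_Mul.
  by rewrite [den _]E den_Zero.
- move=> i u /eqY[_ _ Ei]; rewrite /Y.
  have := congr1 (fun X => X (upd s0 o0 u)) Ei.
  by rewrite !CsetE /= => ->.
- move=> i w /eqY[_ Ei _]; rewrite /Y.
  have := congr1 (fun X => X (upd s0 o1 w)) Ei; rewrite !CsetE /=.
  under eq_exists do rewrite -updC.
  by under [in X in _ = X]eq_exists do rewrite -updC; move=> ->.
- move=> u w Yuw; rewrite /Y -[den _]E6.
  suff : den (tY 0) (fun i => upd (upd s0 o0 w) o1 u (tperm o0 o1 i)) by [].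
  suff -> : (fun i => upd (upd s0 o0 w) o1 u (tperm o0 o1 i)) =
    upd (upd s0 o0 u) o1 w by [].
  apply/funext => i; rewrite /upd; case: tpermP => [->|->|] //.
  by move=> /eqP/negbTE-> /eqP/negbTE->.
rewrite /Y; suff <- : s0 = upd (upd s0 o0 (s0 o0)) o1 (s0 o1) by [].
by apply/funext => i; rewrite /upd; case: eqP => [->//|_]; case: eqP => [->|].
Qed.

End SetAlgebras.

(** * The parallel classes of an affine plane *)

Section ParallelClasses.
Import GRing.Theory.
Local Open Scope ring_scope.
Variable F : finFieldType.
Implicit Types (d e u w x : plane F) (c : F).

Lemma parallel_classZ c d : c != 0 -> parallel_class (c *: d) = parallel_class d.
Proof.
move=> c0; suff lineZ a : line a (c *: d) = line a d.
  by apply/seteqP; split=> _ [a _ <-]; exists a; rewrite // lineZ.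
apply/seteqP; split=> _ [k _ <-]; first by exists (k * c); rewrite // scalerA.
by exists (k / c) => //; rewrite scalerA divfK.
Qed.

(** The line of the class of e through 0 contains 0 and e; as a line in
    direction d, this makes e a multiple of d. *)
Lemma parallel_class_inj d e : e != 0 -> parallel_class d = parallel_class e ->
  exists2 c, c != 0 & e = c *: d.
Proof.
move=> e0 de.
have : parallel_class e (line 0 e) by exists 0.
rewrite -de => -[a _ ae].
have [c1 _ ac1] : line a d 0 by rewrite ae; exists 0; rewrite // scale0r addr0.
have [c2 _ ac2] : line a d e by rewrite ae; exists 1; rewrite // scale1r add0r.
have ecd : e = (c2 - c1) *: d.
  by rewrite -[LHS]subr0 -{1}ac2 -ac1 opprD addrACA subrr add0r scalerBl.
exists (c2 - c1) => //; apply: contraNneq e0 => c0.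
by rewrite ecd c0 scale0r.
Qed.

(** Directions with a nonzero determinant span the plane by the rule of Cramer;
    a zero determinant would make them proportional, hence parallel. *)
Lemma parallel_class_span d e x : d != 0 -> e != 0 ->
  parallel_class d <> parallel_class e -> exists a b, x = a *: d + b *: e.
Proof.
move=> d0 e0 de.
pose cr d e := d 0 0 * e 0 1 - d 0 1 * e 0 0.
have plane_eq u w : u 0 0 = w 0 0 -> u 0 1 = w 0 1 -> u = w.
  move=> uw0 uw1; apply/rowP => -[[|[|]]] //= i2.
    by rewrite (_ : Ordinal i2 = 0) //; exact/val_inj.
  by rewrite (_ : Ordinal i2 = 1) //; exact/val_inj.
have crN0 : cr d e != 0.
  apply/eqP => cr0; apply: de.
  have [c ecd] : exists c, e = c *: d.
    have [d00|d00] := eqVneq (d 0 0) 0.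
      have d01 : d 0 1 != 0.
        by apply: contra_neq d0 => d01; apply: plane_eq; rewrite mxE.
      exists (e 0 1 / d 0 1); apply: plane_eq; rewrite mxE ?divfK //.
      apply: (mulfI d01); move: cr0; rewrite /cr d00 mul0r sub0r mulr0 mulr0.
      by move=> /eqP; rewrite oppr_eq0 => /eqP.
    exists (e 0 0 / d 0 0); apply: plane_eq; rewrite mxE ?divfK //.
    apply: (mulfI d00); rewrite (subr0_eq cr0).
    by field.
  rewrite ecd parallel_classZ //; apply: contra_neq e0 => c0.
  by rewrite ecd c0 scale0r.
exists (cr x e / cr d e), (cr d x / cr d e).
by apply: plane_eq; rewrite !mxE; move: crN0; rewrite /cr => ?; field.
Qed.

Section Numbering.
Variables (p : nat) (Lambda : 'I_p.+1 -> set (set (plane F))).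
Hypothesis Lam_bij : set_bij [set: 'I_p.+1] (parallel_classes F) Lambda.

Lemma Lambda_inj i j : Lambda i = Lambda j -> i = j.
Proof. by case: Lam_bij => _ inj _; apply: inj; rewrite in_setT. Qed.

Lemma Lambda_class i : exists2 d, d != 0 & Lambda i = parallel_class d.
Proof.
by case: Lam_bij => /(_ i I)[d /eqP d0 <-] _ _; exists d.
Qed.

Lemma Lambda_onto d : d != 0 -> exists i, Lambda i = parallel_class d.
Proof.
move=> /eqP d0; case: Lam_bij => _ _ /(_ (parallel_class d))[|i _ <-].
  by exists d.
by exists i.
Qed.

(** Two points determine the direction of the line that joins them, so the
    relation of the i-th class is a condition on the vector w - u alone. *)
Lemma RrelE i u w :
  Rrel (Lambda i) (u, w) <-> u != w /\ Lambda i = parallel_class (w - u).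
Proof.
split=> [[/= /eqP uw [l]]|[uw ->]].
  have [d _ ->] := Lambda_class i => -[a _ <-] [[c1 _ ac1] [c2 _ ac2]]; split=> //.
  have wu : w - u = (c2 - c1) *: d.
    by rewrite -ac1 -ac2 opprD addrACA subrr add0r scalerBl.
  rewrite wu parallel_classZ //; apply: contra_neq uw => c0.
  by apply/esym/eqP; rewrite -subr_eq0 wu c0 scale0r.
split; first exact/eqP.
exists (line u (w - u)); first by exists u.
split; first by exists 0; rewrite // scale0r addr0.
by exists 1; rewrite // scale1r addrC subrK.
Qed.

(** Everything is vector arithmetic on differences of points.  For composition:
    the sum of vectors in two different directions i and j is nonzero and has
    neither direction, and conversely a vector in a third direction is a sum of
    nonzero vectors in the directions i and j. *)
Lemma plane_parallelism :
  parallelism p (fun i u w => Rrel (Lambda (inord i)) (u, w)).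
Proof.
have inord_neq i j : (i <= p)%N -> (j <= p)%N -> j != i ->
    Lambda (inord i) <> Lambda (inord j).
  move=> i_p j_p ji /Lambda_inj/(congr1 val); rewrite /= !inordK // => ij.
  by rewrite ij eqxx in ji.
have neighbour i u : exists w, Rrel (Lambda i) (u, w).
  have [d d0 Ld] := Lambda_class i; exists (u + d); apply/RrelE.
  by rewrite eq_sym -subr_eq0 [u + d]addrC addrK.
have sym i u w : Rrel (Lambda i) (u, w) -> Rrel (Lambda i) (w, u).
  move=> /RrelE[uw Li]; apply/RrelE; rewrite eq_sym uw Li; split=> //.
  by rewrite -opprB -scaleN1r parallel_classZ // oppr_eq0 oner_eq0.
have onto u w : u != w -> exists2 i, (i <= p)%N & Rrel (Lambda (inord i)) (u, w).
  rewrite eq_sym -subr_eq0 => uw; have [i Li] := Lambda_onto uw.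
  exists (i : nat); first by rewrite -ltnS ltn_ord.
  by apply/RrelE; rewrite inord_val eq_sym -subr_eq0 uw.
split.
- move=> u w; split=> [[m m_p /RrelE[/eqP uw _]]|[_ _ /eqP]]; last exact: onto.
  by split=> //; have [z Rwz] := neighbour (inord 0) w; exists z; apply: sym.
- move=> i j u w i_p j_p ji /RrelE[_ Li] /RrelE[_ Lj].
  by apply: (inord_neq i j); rewrite // Li Lj.
- by move=> i u w _; exact: sym.
- move=> i u w z _ /RrelE[uw Li] /RrelE[wz wzE]; rewrite Li in wzE.
  have [|c c0 zw] := parallel_class_inj _ wzE; first by rewrite subr_eq0 eq_sym.
  have [->|uz] := eqVneq u z; first by right.
  left; apply/RrelE; split=> //.
  have zu : z - u = (c + 1) *: (w - u).
    by rewrite scalerDl scale1r -zw addrA subrK.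
  rewrite zu parallel_classZ //; apply: contra_neq uz => c1.
  by apply/esym/eqP; rewrite -subr_eq0 zu c1 scale0r.
- by move=> i u _; split=> _; exact: neighbour.
- by move=> i _; have [w R0w] := neighbour (inord i) 0; exists 0, w.
move=> i j u w i_p j_p ji; have Lij := inord_neq i j i_p j_p ji; split.
  case=> z /RrelE[uz Li] /RrelE[zw Lj].
  move: uz zw; rewrite eq_sym -subr_eq0 [z == w]eq_sym -[w == z]subr_eq0 => uz zw.
  have wu : w - u = (w - z) + (z - u) by rewrite addrA subrK.
  have zuw : z - u = (w - u) - (w - z) by rewrite wu addrAC subrr add0r.
  have zw' : w - z = (w - u) - (z - u) by rewrite wu addrK.
  have uw : u != w.
    apply/eqP => uw; apply: Lij; rewrite Li Lj uw -opprB -scaleN1r.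
    by rewrite parallel_classZ // oppr_eq0 oner_eq0.
  have [k k_p Rk] := onto _ _ uw; have /RrelE[_ Lk] := Rk.
  exists k => //; split=> //; apply/eqP => kE; rewrite kE in Lk.
    have [|c c0 wuE] := parallel_class_inj _ (esym (etrans (esym Lk) Li)).
      by rewrite subr_eq0 eq_sym.
    have zwE : w - z = (c - 1) *: (z - u) by rewrite zw' wuE scalerBl scale1r.
    apply: Lij; rewrite Li Lj zwE parallel_classZ //.
    by apply: contra_neq zw => c1; rewrite zwE c1 scale0r.
  have [|c c0 wuE] := parallel_class_inj _ (esym (etrans (esym Lk) Lj)).
    by rewrite subr_eq0 eq_sym.
  have zuE : z - u = (c - 1) *: (w - z) by rewrite zuw wuE scalerBl scale1r.
  apply: Lij; rewrite Li Lj zuE parallel_classZ //.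
  by apply: contra_neq uz => c1; rewrite zuE c1 scale0r.
case=> k k_p [ki kj /RrelE[uw Lk]].
have [d d0 Li] := Lambda_class (inord i); have [e e0 Lj] := Lambda_class (inord j).
have [a [b wu]] : exists a b, w - u = a *: d + b *: e.
  by apply: parallel_class_span; rewrite // -Li -Lj.
have wu0 : w - u != 0 by rewrite subr_eq0 eq_sym.
have a0 : a != 0.
  apply/eqP => a0; apply: (inord_neq j k); rewrite // Lj Lk wu a0.
  rewrite scale0r add0r parallel_classZ //.
  by apply: contraNneq wu0 => b0; rewrite wu a0 b0 !scale0r addr0.
have b0 : b != 0.
  apply/eqP => b0; apply: (inord_neq i k); rewrite // Li Lk wu b0.
  by rewrite scale0r addr0 parallel_classZ.
exists (u + a *: d); apply/RrelE.
  have uE : u + a *: d - u = a *: d by rewrite addrC addKr.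
  by rewrite Li uE parallel_classZ // eq_sym -subr_eq0 uE scaler_eq0 negb_or a0.
have wE : w - (u + a *: d) = b *: e by rewrite opprD addrA wu addrAC subrr add0r.
by rewrite Lj wE parallel_classZ // eq_sym -subr_eq0 wE scaler_eq0 negb_or b0.
Qed.

End Numbering.
End ParallelClasses.

(** * The equation fails in the modified algebra *)

Section Lifting.
Variables (S T : Type).

Definition rel_inl (r : T -> T -> Prop) (x y : T + S) : Prop :=
  exists u v, [/\ r u v, x = inl u & y = inl v].

Lemma parallelism_inl p (R : nat -> T -> T -> Prop) :
  parallelism p R -> parallelism p (fun i => rel_inl (R i)).
Proof.
move=> [cover disj sym trans dom ex comp]; split.
- move=> x y; split.
    case=> m m_p [u [w [Rm -> ->]]].
    have [[z0 R0u] [z1 R0w] uw] := (cover u w).1 (ex_intro2 _ _ m m_p Rm).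
    by split; [exists (inl z0); exists u, z0|exists (inl z1); exists z1, w|case].
  case=> [[_ [u [z0 [R0u -> _]]]] [_ [z1 [w [R0w _ ->]]]] uw].
  have [|m m_p Rm] := (cover u w).2.
    by split; [exists z0|exists z1|move=> uw'; apply: uw; rewrite uw'].
  by exists m => //; exists u, w.
- move=> i j _ _ i_p j_p ji [u [w [Ri -> ->]]] [u' [w' [Rj [uu'] [ww']]]].
  by rewrite -uu' -ww' in Rj; apply: disj Ri Rj.
- by move=> i _ _ i_p [u [w [Ri -> ->]]]; exists w, u; split=> //; apply: sym.
- move=> i _ _ _ i_p [u [w [Ruw -> ->]]] [w' [z [Rwz [ww'] ->]]].
  rewrite -ww' in Rwz.
  by have [Ruz|->] := trans _ _ _ _ i_p Ruw Rwz; [left; exists u, z|right].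
- move=> i x i_p; split=> -[_ [u [w [Ri -> _]]]].
    by have [z Rz] := (dom i u i_p).1 (ex_intro _ w Ri); exists (inl z), u, z.
  by have [z Rz] := (dom i u i_p).2 (ex_intro _ w Ri); exists (inl z), u, z.
- move=> i i_p; have [u [w Ri]] := ex i i_p.
  by exists (inl u), (inl w), u, w.
move=> i j x y i_p j_p ji; split.
  case=> _ [u [z [Ri -> ->]]] [z' [w [Rj [zz'] ->]]].
  rewrite -zz' in Rj.
  have [k k_p [ki kj Rk]] := (comp i j u w i_p j_p ji).1 (ex_intro2 _ _ z Ri Rj).
  by exists k => //; split=> //; exists u, w.
case=> k k_p [ki kj [u [w [Rk -> ->]]]].
have [|z Ri Rj] := (comp i j u w i_p j_p ji).2; first by exists k.
by exists (inl z); [exists u, z|exists z, w].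
Qed.

End Lifting.

Lemma Pse_closed_bigcup alpha U (A : set (set ('I_alpha -> U))) n
    (X : 'I_n -> set ('I_alpha -> U)) (i : 'I_alpha) : Pse_closed A ->
  (forall k, A (X k)) -> A (\bigcup_k X k).
Proof.
move=> cA AX.
have -> : \bigcup_k X k = [set s | exists2 k, k \in enum 'I_n & X k s].
  by apply/seteqP; split=> s [k _ Xs]; exists k => //; rewrite mem_enum.
elim: (enum _) => [|k l IH].
  have -> : [set s | exists2 k, k \in [::] & X k s] = ~` Dset i i.
    by apply/seteqP; split=> s /= => [[]|]//; case.
  exact: (Pse_closedN cA (Pse_closedD cA i i)).
have -> : [set s | exists2 j, j \in k :: l & X j s] =
    X k `|` [set s | exists2 j, j \in l & X j s].
  apply/seteqP; split=> s /=.
    by case=> j; rewrite inE => /orP[/eqP->|jl] Xj; [left|right; exists j].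
  by case=> [Xk|[j jl Xj]]; [exists k|exists j]; rewrite ?inE ?eqxx ?jl ?orbT.
exact: Pse_closedU.
Qed.

Section Countermodel.
Context {alpha : nat} {ha : 3 <= alpha} {p : nat} (p_gt1 : 1 < p).
Variable K : Astar_data ha p.
Let o0 := ord_0 ha.
Let o1 := ord_1 ha.
Let A := Astar_sets K.

Definition class_rel (i : nat) : Astar_U K -> Astar_U K -> Prop :=
  rel_inl (fun u w => Rrel (Lambda (a := K) (inord i)) (u, w)).

Lemma class_rel_parallelism : parallelism p class_rel.
Proof. exact: parallelism_inl (plane_parallelism (Lam_bij K)). Qed.

Lemma tail_exists :
  exists t : 'I_alpha -> Astar_U K, forall j : 'I_alpha, 2 <= j -> block (t j) = j.-1.
Proof.
suff /choice[t tP] : forall j : 'I_alpha, exists x : Astar_U K,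
    2 <= j -> block x = j.-1 by exists t.
move=> j; have [j2|j2] := leqP 2 j; last by exists (inl 0%R).
have jk : j.-2 < alpha.-2.
  by rewrite -!subn2 ltn_sub2r.
have /fintype.card_gt0P[x _] : 0 < #|@Ublk _ _ _ K (Ordinal jk)|.
  by rewrite V_card -subn1 subn_gt0.
exists (inr (Tagged (@Ublk _ _ _ K) x)) => _ /=.
by case: (j : nat) j2 => [|[]].
Qed.

(** As T is nonempty, cylindrifying R_i x T from 2 on leaves the condition that
    the first two coordinates are in R_i. *)
Lemma class_rel_timesT i :
  binary ha (class_rel i) =
  foldr Cset (timesT ha (Rrel (Lambda (a := K) (inord i))))
    [seq j : 'I_alpha <- enum 'I_alpha | 2 <= j].
Proof.
rewrite Cset_foldr_geE (tCyls2_binary ha); apply/binary_inj => x y; split.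
  case=> u [w [Ruw -> ->]]; have [t tP] := tail_exists.
  exists (upd (upd t o0 (inl u)) o1 (inl w)); split=> //; split.
    by exists u, w.
  by move=> [[|[|j]] hj] // j2; rewrite /upd /= tP.
by case=> s [[[u [w [Ruw s0 s1]]] _] <- <-]; exists u, w.
Qed.

Lemma timesT0_class s :
  timesT ha (Rrel (Lambda (a := K) ord0)) s -> binary ha (class_rel 0) s.
Proof.
case=> -[u [w [Ruw s0 s1]]] _; exists u, w; split=> //.
by rewrite (_ : inord 0 = ord0) //; apply/val_inj; rewrite /= inordK.
Qed.

Lemma Astar_Qrel k : A (Qrel (a := K) k).
Proof. by apply: sub_gen_smallest; left; exists k. Qed.

(** R_0 x T is not a generator, but it is the union of the Q_k. *)
Lemma Astar_class_rel i : A (binary ha (class_rel i)).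
Proof.
have cA : Pse_closed A := Astar_closed K.
rewrite class_rel_timesT; elim: [seq j <- _ | _] => [|j l IH] /=; last first.
  exact: (Pse_closedC cA).
case: (posnP (inord i : 'I_p.+1)) => [i0|i_gt0]; last first.
  by apply: sub_gen_smallest; right; exists (inord i).
rewrite (_ : inord i = ord0); last exact/val_inj.
rewrite -Q_cover; apply: (Pse_closed_bigcup o0 cA) => k; exact: Astar_Qrel.
Qed.

Variable f : A -> A.
Hypothesis f_star : is_Pstar f.

(** For tau = 1, composing with [0,1] and normalizing gives back the identity:
    the modified operation fixes each Q_k, whereas the true one sends Q_k to
    Q_(p-2-k). *)
Lemma Pstar_Qrel (X : A) k : val X = Qrel (a := K) k -> val (f X) = Qrel (a := K) k.
Proof.
have Sset1 Y : Sset 1%g Y = Y :> set ('I_alpha -> Astar_U K).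
  rewrite /Sset; apply/seteqP; split=> s /=;
    by rewrite (_ : (fun i => s ((1%g : {perm 'I_alpha}) i)) = s) //;
    apply/funext => i; rewrite perm1.
have pplus1 : pplus ha 1%g = 1%g by rewrite /pplus !perm1.
move=> XQ; have := Pstar_Q f_star (tau := 1%g) (k := k) (X := X).
rewrite pplus1 Sset1 => /(_ XQ) ->.
by rewrite /perm_comp mul1g /pplus tpermL tpermR /= /perm_comp tperm2 Sset1.
Qed.

Lemma Astar_not_models_e_p : ~ models (Astar f) (e_p ha p).
Proof.
move=> mod.
have p_gt0 : 0 < p by exact: ltnW.
have n_gt0 : 0 < p.-1 by rewrite -subn1 subn_gt0.
pose Q k := Qrel (a := K) (insubd (Ordinal n_gt0) k).
pose v z : Astar f := match z with
  | VarX i => SigSub (mem_set (Astar_class_rel i))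
  | VarY k => SigSub (mem_set (Astar_Qrel (insubd (Ordinal n_gt0) k)))
  end.
have QX k s : Q k s -> binary ha (class_rel 0) s.
  move=> Qs; apply: timesT0_class; rewrite -Q_cover.
  by exists (insubd (Ordinal n_gt0) k).
have /evalP := mod v; set cA := Astar_closed K.
pose den := denotation cA f v.
have denX i : den (tX i) = binary ha (class_rel i) by [].
have denY k : den (tY k) = Q k by [].
pose s0 : 'I_alpha -> Astar_U K := fun=> inl 0%R.
rewrite /satisfied den_Zero => /(congr1 (fun X => X s0)) test.
suff : False by []; rewrite -[False]/(set0 s0) -test.
apply/den_test/sat_E_p; split.
  exact/(sat_parallelism (inl 0%R) p_gt0 (fun i _ => denX i))/class_rel_parallelism.
have denP : den (P01 (tY 0)) = Q 0 by apply: Pstar_Qrel.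
have satE t1 t2 : satisfied cA f v (t1, t2) = (den t1 = den t2) by [].
move=> i j i_n j_n ji; rewrite /eqsY !forall_cons /eqLe !satE.
rewrite /den den_Zero den_Cyls den_Add den_Mul !den_Cyl -/den !denX !denY denP.
split; [|split; [|split; [|split; [|split; [|split]]]]] => //.
- rewrite Cset1_binary; apply/seteqP; split=> s /=.
    case=> s' /QX[u [w [Ruw s'0 _]]] /(_ o0 isT) s0E.
    by exists (inl w), u, w; rewrite -s'0.
  case=> _ [u [w [Ruw s0u _]]]; have [t tP] := tail_exists.
  pose s' := upd (upd t o0 (inl u)) o1 (inl w).
  have : Cset o1 (timesT ha (Rrel (Lambda (a := K) ord0))) s'.
    exists s' => //; split.
      exists u, w; split=> //.
      by rewrite (_ : ord0 = inord 0) //; apply/val_inj; rewrite /= inordK.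
    by move=> [[|[|m]] hm] // m2; rewrite /upd /= tP.
  (* Q_0 and R_0 x T have the same cylindrification along 1, hence the same
     projection to the coordinate 0. *)
  rewrite -(Q_cyl K (insubd (Ordinal n_gt0) 0)) => -[s'' Qs'' s's''].
  exists s'' => // -[[|//] hm] _; rewrite -s's'' //.
  by rewrite (_ : Ordinal hm = o0); [rewrite s0u|apply/val_inj].
- by apply/seteqP; split=> s; [case=> // /QX|right].
- apply: Q_disjoint => /(congr1 val).
  by rewrite !val_insubd i_n j_n => /eqP; rewrite eq_sym (negbTE ji).
- by rewrite /Q !Q_cyl.
- by rewrite /Q !Q_cyl.
Qed.

End Countermodel.

Theorem lemma10 (alpha : nat) (ha : 3 <= alpha) (p : nat)
  (hp : odd_prime_power p) :
  (forall (K : Astar_data ha p) (f : Astar_sets K -> Astar_sets K),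
     is_Pstar f -> ~ models (Astar f) (e_p ha p)) /\
  (forall B : Pse alpha, models (Pse_algebra ha B) (e_p ha p)).
Proof.
have [p_odd [q [k [q_prime k_gt0 pE]]]] := hp.
have p_gt1 : 1 < p by rewrite pE -(exp1n k) ltn_exp2r // prime_gt1.
split=> [K f f_star|B]; first exact: Astar_not_models_e_p.
exact: Pse_models_e_p.
Qed.
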